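(* There exist two infinite sequences of positive integers $A$ and $B = \{b_1 < b_2 < b_3 < \cdots\}$ with $b_1 \in \{4, 7, 8\} \cup \{b \in \mathbb{N} : b \geq 11\}$, $3b_1 + 5 \leq b_2 \leq 6b_1 + 10$ and $b_3 = b_2 + b_1 + 1$ such that $P(A) = \mathbb{N} \setminus B$.
   Context: $\mathbb{N}$ denotes the set of all nonnegative integers. For a set $A = \{a_1 < a_2 < \cdots\}$ of positive integers, $P(A) = \{\sum \varepsilon_i a_i : a_i \in A,\ \varepsilon_i \in \{0,1\},\ \sum \varepsilon_i < \infty\}$ is the set of all finite subset sums of $A$; in particular $0 \in P(A)$ (empty sum). *)

(* Defs.v *)
From mathcomp Require Export all_boot finmap.
From mathcomp Require Export mathcomp_extra boolp classical_sets.

Set Implicit Arguments.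
Unset Strict Implicit.
Unset Printing Implicit Defensive.

Local Open Scope classical_set_scope.

(* An infinite set of positive integers is given by its increasing
   enumeration. *)
Definition pos_increasing (a : nat -> nat) : Prop :=
  (forall i, 0 < a i) /\ {homo a : i j / i < j}.

(* The 0/1 choice of coefficients with finite sum is the finite subset F of A
   on which the coefficient is 1. *)
Definition subset_sums (A : set nat) : set nat :=
  [set n | exists2 F : {fset nat}, [set` F] `<=` A & n = \sum_(x <- F) x].

(* Main.v *)
Require Import Defs.
From mathcomp Require Import zify.

Local Open Scope classical_set_scope.

(** Take A = {1, 2, 5, 6, 7} together with the numbers 24 * 2 ^ j.  The subset
    sums of {1, 2, 5, 6, 7} are all the numbers up to 21 except 4 and 17, and
    those of the numbers 24 * 2 ^ j are exactly the multiples of 24.  Hence P(A)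
    consists of the n whose residue modulo 24 is none of 4, 17, 22, 23, and
    B = {4, 17, 22, 23, 28, ...} has 22 = 17 + 4 + 1. *)

Definition small_terms : seq nat := [:: 1; 2; 5; 6; 7].

Definition missing_residues : seq nat := [:: 4; 17; 22; 23].

Definition sum_seq (i : nat) : nat :=
  if i < 5 then nth 0 small_terms i else 24 * 2 ^ (i - 5).

Definition missing_seq (i : nat) : nat :=
  24 * (i %/ 4) + nth 0 missing_residues (i %% 4).

Lemma pos_increasing_sum_seq : pos_increasing sum_seq.
Proof.
rewrite /sum_seq; split=> [i|].
  case: (ltnP i 5) => [|_]; first by case: i => [|[|[|[|[|]]]]].
  by rewrite muln_gt0 expn_gt0.
apply: (homo_ltn ltn_trans) => i.
case: i => [|[|[|[|[|i]]]]] //=.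
by rewrite !subSS !subn0 ltn_pmul2l // ltn_exp2l.
Qed.

Lemma pos_increasing_missing_seq : pos_increasing missing_seq.
Proof.
rewrite /missing_seq; split=> [i|].
  by have := @ltn_pmod i 4 isT; case: (i %% 4) => [|[|[|[|]]]] //= _; lia.
apply: (homo_ltn ltn_trans) => i.
have := @ltn_pmod i 4 isT; have := divn_eq i 4.
(* With [i = q * 4 + r], the successor is [q * 4 + r.+1]; only for [r = 3] does it carry into the
   next block of 24. *)
case: (i %% 4) (i %/ 4) => [|[|[|[|]]]] // q -> _;
  by rewrite -(addnS (q * 4)) !divnMDl // !modnMDl /=; lia.
Qed.

Lemma range_sum_seq n :
  range sum_seq n <-> n \in small_terms \/ exists j, n = 24 * 2 ^ j.
Proof.
split=> [[i _ <-]|[]].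
- rewrite /sum_seq; case: ltnP => [i5|_]; last by right; exists (i - 5).
  by left; apply: mem_nth.
- by move=> /(nthP 0)[i i5 <-]; exists i => //; rewrite /sum_seq i5.
- by move=> [j ->]; exists (j + 5) => //; rewrite /sum_seq addnK ltnNge leq_addl.
Qed.

Lemma range_missing_seq n :
  range missing_seq n <-> n %% 24 \in missing_residues.
Proof.
split=> [[i _ <-]|/(nthP 0)[k k4 nk]].
  rewrite /missing_seq mulnC modnMDl.
  by have := @ltn_pmod i 4 isT; case: (i %% 4) => [|[|[|[|]]]].
(* Each block of 24 holds four missing numbers, and [n] is number [k] of its block. *)
exists (n %/ 24 * 4 + k) => //.
rewrite /missing_seq modnMDl divnMDl // (modn_small k4) (divn_small k4) nk addn0.
by rewrite [RHS](divn_eq n 24) mulnC.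
Qed.

(** Lets the summands be built by list operations, with [uniq] ensuring that none is used twice. *)
Lemma subset_sums_seq (A : set nat) (s : seq nat) :
  uniq s -> (forall x, x \in s -> A x) -> subset_sums A (\sum_(x <- s) x).
Proof.
move=> us sA; exists [fset x in s]%fset => [x /=|].
  by rewrite inE => /sA.
apply: perm_big; apply: uniq_perm => // [|x]; first exact: fset_uniq.
by rewrite inE.
Qed.

(** Binary expansion of [m], scaled by [d]. The bound [j < k] keeps a new top power distinct from
    those supplied by the induction hypothesis. *)
Lemma sum_mul_pow2 (d k m : nat) : 0 < d -> m < 2 ^ k ->
  exists s : seq nat, [/\ uniq s,
    forall x, x \in s -> exists2 j, j < k & x = d * 2 ^ j
    & \sum_(x <- s) x = d * m].
Proof.
move=> d0; elim: k m => [|k IH] m.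
  by rewrite expn0 ltnS leqn0 => /eqP ->; exists [::]; rewrite big_nil muln0.
rewrite expnS => mk; have [lt_mk|le_km] := ltnP m (2 ^ k).
  have [s [us sk sm]] := IH m lt_mk; exists s; split=> // x /sk[j jk ->].
  by exists j => //; apply: ltnW.
have [|s [us sk sm]] := IH (m - 2 ^ k); first by lia.
exists (d * 2 ^ k :: s); split.
- rewrite /= us andbT; apply/negP => /sk[j jk /eqP].
  by rewrite eqn_pmul2l // eqn_exp2l // => /eqP kj; move: jk; rewrite kj ltnn.
- move=> x; rewrite inE => /predU1P[->|/sk[j jk ->]]; first by exists k.
  by exists j => //; apply: ltnW.
- by rewrite big_cons sm -mulnDr subnKC.
Qed.

Lemma small_terms_lt x : x \in small_terms -> x < 24.
Proof. by move: x; apply/allP. Qed.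

Lemma small_terms_sum r : r < 24 -> r \notin missing_residues ->
  exists2 s, subseq s small_terms & \sum_(x <- s) x = r.
Proof.
move=> r24 rB.
(* Entry [r] sums to [r]. Entries 4 and 17 are placeholders, and 22 and 23 fall past the end; [rB]
   excludes all four. *)
pose t := [:: [::]; [:: 1]; [:: 2]; [:: 1; 2]; [::]; [:: 5]; [:: 6]; [:: 7];
  [:: 1; 7]; [:: 2; 7]; [:: 1; 2; 7]; [:: 5; 6]; [:: 5; 7]; [:: 6; 7];
  [:: 1; 6; 7]; [:: 2; 6; 7]; [:: 1; 2; 6; 7]; [::]; [:: 5; 6; 7];
  [:: 1; 5; 6; 7]; [:: 2; 5; 6; 7]; [:: 1; 2; 5; 6; 7]].
exists (nth [::] t r); first by move: r24 rB; do 24 (case: r => [|r] //).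
by rewrite -sumnE; move: r24 rB; do 24 (case: r => [|r] //).
Qed.

(** A choice of summands is five booleans, so 32 computations settle it. *)
Lemma sum_small_terms_mod (p : pred nat) :
  (\sum_(x <- small_terms | p x) x) %% 24 \notin missing_residues.
Proof.
rewrite unlock /=.
by case: (p 1); case: (p 2); case: (p 5); case: (p 6); case: (p 7).
Qed.

Lemma subset_sums_sum_seq n :
  subset_sums (range sum_seq) n <-> n %% 24 \notin missing_residues.
Proof.
split=> [[F FA ->]|nB].
  have s_lt x : x \in F -> x < 24 -> x \in small_terms.
    move=> xF; have /range_sum_seq[//|[j ->]] := FA _ xF.
    by rewrite -[X in _ < X]muln1 ltn_pmul2l // ltnNge expn_gt0.
  have b_ge x : x \in F -> ~~ (x < 24) -> 24 %| x.
    move=> xF; have /range_sum_seq[xs|[j ->]] := FA _ xF; last by rewrite dvdn_mulr.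
    by rewrite small_terms_lt.
  (* Modulo 24 only the elements of [F] below 24 matter, and these are small terms. *)
  rewrite (bigID (fun x => x < 24)) /=.
  have /dvdnP[q ->] : 24 %| \sum_(x <- F | ~~ (x < 24)) x.
    by rewrite big_seq_cond; apply: dvdn_sum => x /andP[/b_ge].
  rewrite addnC modnMDl.
  suff -> : \sum_(x <- F | x < 24) x = \sum_(x <- small_terms | x \in F) x.
    exact: sum_small_terms_mod.
  rewrite -big_filter -[RHS]big_filter; apply: perm_big.
  apply: uniq_perm; rewrite ?filter_uniq // => x; rewrite !mem_filter.
  apply/andP/andP => [[x24 xF]|[xF xs]]; split=> //; first exact: s_lt.
  exact: small_terms_lt.
(* Conversely, [s] produces the residue of [n], and [t] produces 24 times the quotient [q]; since
   [q < 2 ^ q], [q] binary digits suffice. *)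
have [s ss sr] := small_terms_sum _ (ltn_pmod n (isT : 0 < 24)) nB.
have [t [ut tk tq]] :=
  sum_mul_pow2 _ _ _ (isT : 0 < 24) (ltn_expl (n %/ 24) (isT : 1 < 2)).
have -> : n = \sum_(x <- s ++ t) x.
  by rewrite big_cat /= sr tq addnC mulnC -divn_eq.
have s_lt x : x \in s -> x < 24.
  by move/(mem_subseq ss)/small_terms_lt.
apply: subset_sums_seq => [|x].
  (* The two lists are disjoint: members of [s] are below 24, those of [t] are not. *)
  rewrite cat_uniq ut andbT (subseq_uniq ss) //=; apply/hasPn => x /tk[j _ ->].
  by apply/negP => /s_lt; rewrite -[X in _ < X]muln1 ltn_pmul2l // ltnNge expn_gt0.
rewrite mem_cat => /orP[/(mem_subseq ss) xs|/tk[j _ ->]].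
  by apply/range_sum_seq; left.
by apply/range_sum_seq; right; exists j.
Qed.

(* b is indexed from 0: b 0, b 1, b 2 are b_1, b_2, b_3. *)
Theorem theorem1p2 :
  exists a b : nat -> nat,
    [/\ pos_increasing a /\ pos_increasing b,
        ([set 4; 7; 8] `|` [set m | 11 <= m]) (b 0),
        3 * b 0 + 5 <= b 1 <= 6 * b 0 + 10,
        b 2 = b 1 + b 0 + 1
      & subset_sums (range a) = setT `\` range b].
Proof.
(* The numerical conditions compute to [17 <= 17 <= 34] and [22 = 17 + 4 + 1]. *)
exists sum_seq, missing_seq; split=> //.
- by split; [exact: pos_increasing_sum_seq | exact: pos_increasing_missing_seq].
- by left; left; left.
- apply/seteqP; split=> n.
    move=> /subset_sums_sum_seq nB; split=> //.
    by move/range_missing_seq; apply/negP.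
  move=> [_ nB]; apply/subset_sums_sum_seq/negP => nR.
  by apply/nB/range_missing_seq.
Qed.
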